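(* $n(3,17) \leq 2048$; that is, there exists a $3$-regular graph of girth exactly $17$ with at most $2048$ vertices.
   Context: Graphs are finite and simple. For integers $k\ge 2$, $g\ge 3$, a $(k,g)$-graph is a $k$-regular graph with girth $g$ (the length of a shortest cycle is exactly $g$). $n(k,g)$ denotes the smallest possible number of vertices of a $(k,g)$-graph. *)

(* Defs.v *)
From mathcomp Require Import all_boot.

Set Implicit Arguments.
Unset Strict Implicit.
Unset Printing Implicit Defensive.

Record sgraph := SGraph {
  vertex :> finType;
  adj : rel vertex;
  adj_sym : symmetric adj;
  adj_irrefl : irreflexive adj
}.

Definition regular (G : sgraph) (k : nat) : Prop :=
  forall x : G, #|[set y : G | adj x y]| = k.

(* [ucycle] also accepts the empty sequence and, adjacency being symmetric,
   [:: x; y] for any edge xy; the size condition rules these out. *)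
Definition graph_cycle (G : sgraph) (c : seq G) : Prop :=
  ucycle (@adj G) c /\ 2 < size c.

(* The girth is a relation, so that an acyclic graph has no (finite) girth. *)
Definition has_girth (G : sgraph) (g : nat) : Prop :=
  (exists2 c : seq G, graph_cycle c & size c = g) /\
  (forall c : seq G, graph_cycle c -> g <= size c).

Definition kg_graph (k g : nat) (G : sgraph) : Prop :=
  regular G k /\ has_girth G g.

(* [min_order k g n] reads "n(k,g) = n". It is a relation, so no default value
   is needed for parameters k, g admitting no (k,g)-graph. *)
Definition min_order (k g n : nat) : Prop :=
  (exists2 G : sgraph, kg_graph k g G & #|G| = n) /\
  (forall G : sgraph, kg_graph k g G -> n <= #|G|).

(* Main.v *)
Require Import Defs.
From mathcomp Require Import all_boot zify.
From Stdlib Require Import NArith FMapPositive Classical_Prop.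

(** The witness is a lift of K4, with one edge replaced by semi-edges at its
    two ends, by voltages in a group of order 512, found by computer search.  That its girth is at least 17 is a local condition: a
    cycle of length at most 16 through x splits into two different simple paths
    of length at most 8 from x to an antipodal vertex, so it is excluded as soon
    as the non-backtracking walks of length at most 8 from x have pairwise
    different endpoints.  This is checked at every vertex by computation, and a
    17-cycle is exhibited. *)

Set Implicit Arguments.
Unset Strict Implicit.
Unset Printing Implicit Defensive.

(** The parity of the girth suits a test rooted at vertices: 17 = 2 * 8 + 1, so a ball of radius 8
    without coincidences forbids exactly the lengths up to 16. In a cubic graph such a ball has 1 +
    3 (2^8 - 1) = 766 vertices, the Moore bound for girth 17. Non-backtracking walks are enumerated
    instead of simple paths because the recursion then remembers only the previous vertex; nothing
    is lost, since in girth at least 17 these walks are simple up to length 8 and have different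
    endpoints. In the base graph the replaced edge joins vertices 1 and 2. A semi-edge lifts to a
    perfect matching inside its fibre, which keeps the degree 3, and the four fibres give 4 * 512 =
    2048 vertices. The voltage group is transitive on each fibre, so by symmetry four roots would
    represent all; testing all 2048 roots, about 1.6 million endpoints, asks for nothing but the
    table. Since [min_order] is a relation, that n(3,17) has a value at all must be derived from the
    existence of the witness. *)

(** This is how absence of repetition is used in a tree: it passes down to each branch, and any
    member of a branch identifies that branch. *)
Lemma uniq_flatten_map (S T : eqType) (f : S -> seq T) (s : seq S) :
  uniq (flatten [seq f y | y <- s]) ->
  (forall y, y \in s -> uniq (f y)) /\
  (forall y z w, y \in s -> z \in s -> w \in f y -> w \in f z -> y = z).
Proof.
elim: s => [|x s IHs] //=; rewrite cat_uniq => /and3P[ux /hasPn dx /IHs[us ds]].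
have dxs w z : z \in s -> w \in f z -> w \in f x -> False.
  by move=> zs wz; apply/negP/dx/flatten_mapP; exists z.
split=> [y|y z w]; first by rewrite inE => /predU1P[->|/us].
rewrite !inE => /predU1P[->|ys] /predU1P[->|zs] //; last exact: ds.
- by move=> wx wz; case: (dxs _ _ zs wz wx).
- by move=> wy wx; case: (dxs _ _ ys wy wx).
Qed.

(** * Non-backtracking walks and short cycles *)

Section Spread.

Variables (T : eqType) (nbr : T -> seq T).

(* Endpoints, with multiplicity, of the non-backtracking walks of length at most
   [k] from [x] whose first step does not go to [p]. *)
Fixpoint spread (k : nat) (p x : T) : seq T :=
  if k is k'.+1 then
    x :: flatten [seq spread k' x y | y <- [seq y <- nbr x | y != p]]
  else [:: x].

Let edge : rel T := fun x y => y \in nbr x.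

(** The whole path avoids [p], although [spread] forbids [p] only at the first step. This form is
    inherited by the tail: there the forbidden vertex is the one just left, and simplicity of the
    path keeps it from returning. *)
Definition wander k p x s :=
  [&& path edge x s, uniq (x :: s), p \notin s & size s <= k].

Lemma wander_cons k p x y s :
  wander k.+1 p x (y :: s) ->
  y \in [seq y <- nbr x | y != p] /\ wander k x y s.
Proof.
case/and4P=> /andP[exy es] /andP[]; rewrite inE negb_or => /andP[_ xs] uys.
rewrite inE negb_or => /andP[neq_py _] szs.
by rewrite mem_filter eq_sym neq_py; split; last apply/and4P.
Qed.

Lemma last_spread k p x s : wander k p x s -> last x s \in spread k p x.
Proof.
elim: k p x s => [|k IHk] p x [|y s]; rewrite ?mem_head //.
  by rewrite /wander ltn0 !andbF.
case/wander_cons=> Fy /IHk ls; rewrite in_cons; apply/orP; right.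
by apply/flatten_mapP; exists y.
Qed.

(** A list [spread k p x] without repetition places each vertex at one node of the tree of walks at
    most, and the node determines the path leading to it. Distinctness acts at three levels: the
    root against everything below it, the branches against each other, and each branch within
    itself. *)
Lemma wander_last_inj k p x s t :
  uniq (spread k p x) -> wander k p x s -> wander k p x t ->
  last x s = last x t -> s = t.
Proof.
elim: k p x s t => [|k IHk] p x s t.
  by case: s t => [|? ?] [|? ?] // _; rewrite /wander ltn0 !andbF.
case/andP=> xN /uniq_flatten_map[uF dF].
(* The empty path ends at the root, a nonempty one in some branch below; the root does not occur
   again there. *)
have nil_case y u : wander k.+1 p x (y :: u) -> x <> last y u.
  case/wander_cons=> Fy /last_spread lu eqx; case/negP: xN.
  by apply/flatten_mapP; exists y; rewrite // {1}eqx.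
case: s t => [|y s] [|z t] // ws wt /=; first by move/(nil_case _ _ wt).
  by move/esym/(nil_case _ _ ws).
have [Fy ws'] := wander_cons ws; have [Fz wt'] := wander_cons wt.
(* The common endpoint lies in the branches of both first steps, and different branches are
   disjoint. *)
move=> eqst; have eq_yz : y = z.
  by apply: dF Fy Fz (last_spread ws') _; rewrite eqst last_spread.
by subst z; congr (_ :: _); apply: IHk (uF y Fy) ws' wt' eqst.
Qed.

(* [p := x] excludes nothing, as [x] is not its own neighbour on a simple path. *)
Lemma short_cycle_spread k x c :
  symmetric edge -> 2 < size (x :: c) <= k.*2 -> ucycle edge (x :: c) ->
  ~~ uniq (spread k x x).
Proof.
(* For a cycle of length L, [size c] is L - 1 and [m.+1] is L/2 rounded down. Cutting [c] at
   position [m] yields two arcs of lengths L/2 rounded down and rounded up, both at most [k] because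
   L is at most 2k. *)
move=> esym /= szc /andP[]; set m := (size c).-1./2.
have mc : m < size c by rewrite /m; lia.
rewrite -{1 2}(cat_take_drop m c) (drop_nth x) //.
have := size_takel (ltnW mc); have := size_drop m.+1 c.
(* From here on the cycle reads [x], [s], [y], [t], with [y] antipodal to [x]. The two arcs from [x]
   to [y] are [rcons s y] and, run backwards, [rcons (rev t) y]. *)
move: (take m c) (nth x c m) (drop m.+1 c) => s y t szt szs.
rewrite -cat_rcons /= rcons_cat cat_path last_rcons => /andP[es et].
rewrite mem_cat negb_or cat_uniq => /andP[/andP[xs xt] /and3P[us /hasPn dst ut]].
apply/negP => /wander_last_inj inj.
have {inj} := inj (rcons s y) (rcons (rev t) y); rewrite !last_rcons.
(* Equal arcs would give [s = rev t]. As [s] and [t] are disjoint, both would be empty and the cycle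
   would have length 2. *)
have eq_false : rcons s y <> rcons (rev t) y.
  case/rcons_inj => eq_st; case: (s) eq_st szs szt dst => [|z s'] /= eq_st szs szt.
    by move/(congr1 size): eq_st; rewrite size_rev /= /m in szt szs *; lia.
  by move/(_ z); rewrite -mem_rev -eq_st !mem_head => /(_ isT).
move=> inj; case: eq_false; have yt : y \notin t.
  by apply/negP => /dst; rewrite mem_rcons mem_head.
have neq_xy : x != y by move: xs; rewrite mem_rcons inE negb_or => /andP[].
apply: inj => //; apply/and4P; split=> //=.
- by rewrite xs us.
- by rewrite size_rcons szs /m; lia.
(* The second arc runs against the orientation of the cycle, which is where symmetry of [edge]
   enters. *)
- rewrite (eq_path esym) -(last_rcons y t x) -rev_cons -(belast_rcons y t x).
  by rewrite rev_path.
- by rewrite !mem_rcons !inE mem_rev negb_or neq_xy xt rcons_uniq mem_rev yt rev_uniq.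
- by rewrite mem_rcons inE mem_rev negb_or neq_xy.
- by rewrite size_rcons size_rev szt /m; lia.
Qed.

End Spread.

(** * From one (k,g)-graph to the minimum order *)

Lemma min_order_exists k g G :
  kg_graph k g G -> exists2 n, min_order k g n & n <= #|G|.
Proof.
(* Descent on the order, run as an induction on an upper bound [m] for it; at bound 0 the graph [G]
   is trivially of least order. *)
move: {2}#|G| (leqnn #|G|) => m; elim: m G => [|m IHm] G leGm kgG.
  exists #|G| => //; split; first by exists G.
  by move=> H _; apply: leq_trans leGm _.
(* Whether a smaller (k,g)-graph exists is a proposition quantified over all graphs, not a boolean,
   so the least order is reached by excluded middle. *)
case: (classic (exists2 H : sgraph, kg_graph k g H & #|H| < #|G|)).
  case=> H kgH ltHG; case: (IHm H _ kgH); first by rewrite -ltnS (leq_trans ltHG).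
  by move=> n minn len; exists n => //; apply: leq_trans len (ltnW ltHG).
move=> noH; exists #|G| => //; split=> [|H kgH]; first by exists G.
by rewrite leqNgt; apply/negP => ltHG; apply: noH; exists H.
Qed.

(** * Graphs given by a table of neighbours, and a criterion for odd girth *)

Section TableGraph.

Variables (n : nat) (nbr : N -> seq N).

Let edge : rel N := fun x y => y \in nbr x.

(** Computations run on binary integers; ordinals, with their unary values and proofs, serve only as
    the vertex type demanded by [sgraph]. *)
Definition code (i : 'I_n) : N := N.of_nat i.

Definition table_adj : rel 'I_n := relpre code edge.

Definition vertices : seq N := [seq N.of_nat i | i <- iota 0 n].

(** Distinct entries make the length of a row the degree of its vertex. The range test lets every
    entry be decoded to an ordinal by [codeP], so that no neighbour is lost on passing to the
    graph. *)
Definition table_ok (k : nat) : bool :=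
  all (fun x => [&& size (nbr x) == k, uniq (nbr x), x \notin nbr x
     & all (fun y => N.ltb y (N.of_nat n) && (x \in nbr y)) (nbr x)]) vertices.

Lemma code_inj : injective code.
Proof. by move=> i j /Nat2N.inj/val_inj. Qed.

Lemma mem_code i : code i \in vertices.
Proof. by apply: map_f; rewrite mem_iota /=. Qed.

Lemma codeP x : N.ltb x (N.of_nat n) -> exists i, code i = x.
Proof.
move=> /N.ltb_lt ltxn; have ltx : N.to_nat x < n by lia.
by exists (Ordinal ltx); rewrite /code N2Nat.id.
Qed.

Section Ok.

Variables (k : nat) (ok : table_ok k).

Lemma table_adj_irrefl : irreflexive table_adj.
Proof.
by move=> i; apply/negbTE; have /and4P[] := allP ok _ (mem_code i).
Qed.

Lemma table_adj_sym : symmetric table_adj.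
Proof.
suff sub i j : table_adj i j -> table_adj j i by move=> i j; apply/idP/idP; apply: sub.
have /and4P[_ _ _ /allP ok_i] := allP ok _ (mem_code i).
by move=> /ok_i/andP[].
Qed.

Definition table_graph := SGraph table_adj_sym table_adj_irrefl.

Lemma table_graph_regular : regular table_graph k.
Proof.
move=> i; have /and4P[/eqP <- uniq_i _ /allP ok_i] := allP ok _ (mem_code i).
(* Degrees are compared through [code]: the encoded neighbour set of [i] is a permutation of the row
   of [code i]. *)
rewrite cardE -(size_map code); apply: perm_size; apply: uniq_perm => //.
  by rewrite (map_inj_uniq code_inj) enum_uniq.
move=> x; apply/mapP/idP => [[j]|ix]; first by rewrite mem_enum inE => ij ->.
have /andP[/codeP[j jx] _] := ok_i _ ix.
by exists j; rewrite // mem_enum inE /adj /= /table_adj /= jx.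
Qed.

(** [short_cycle_spread] asks for symmetry on the whole of [N], while the table speaks of the codes
    below [n]. Empty rows outside the range close the gap: an edge starts in the range, and the test
    on its row provides the reverse edge. *)
Lemma edge_sym : (forall x, ~~ N.ltb x (N.of_nat n) -> nbr x = [::]) ->
  symmetric edge.
Proof.
move=> out; suff sub x y : edge x y -> edge y x by move=> x y; apply/idP/idP; apply: sub.
case: (boolP (N.ltb x (N.of_nat n))) => [/codeP[i <-] | /out]; last first.
  by rewrite /edge => ->.
have /and4P[_ _ _ /allP ok_i] := allP ok _ (mem_code i).
by move=> /ok_i/andP[].
Qed.

Lemma graph_cycle_code (c : seq table_graph) :
  graph_cycle c <-> ucycle edge (map code c) /\ 2 < size (map code c).
Proof. by rewrite /graph_cycle /ucycle (map_inj_uniq code_inj) cycle_map size_map. Qed.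

(** Depth [g] at every root excludes the lengths up to 2g, and the cycle [l] attains the next one.
    Positivity of [g] makes [l] long enough to count as a cycle of a simple graph. *)
Lemma table_graph_girth g l :
  (forall x, ~~ N.ltb x (N.of_nat n) -> nbr x = [::]) ->
  all (fun x => uniq (spread nbr g x x)) vertices ->
  ucycle edge l -> all (fun x => N.ltb x (N.of_nat n)) l ->
  size l = g.*2.+1 -> 0 < g ->
  has_girth table_graph g.*2.+1.
Proof.
move=> out /allP tree_g cyc_l lt_l szl g_gt0; split.
  have [c lc] : exists c, map code c = l.
    elim: l lt_l {cyc_l szl} => [|x l IHl]; first by exists [::].
    by case/andP=> /codeP[i <-] /IHl[c <-]; exists (i :: c).
  exists c; last by rewrite -szl -lc size_map.
  by apply/graph_cycle_code; rewrite lc szl; split=> //; lia.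
move=> c /graph_cycle_code[]; rewrite -(size_map code) ltnNge => cyc sz2.
apply/negP => szg; case: c cyc sz2 szg => [|x c] // cyc sz2 szg.
(* A cycle of length at most 2g is viewed from its first vertex, which may be any vertex; hence the
   hypothesis at all roots. *)
have szc : 2 < size (code x :: map code c) <= g.*2 by move: sz2 szg; rewrite /=; lia.
have /negP[] := short_cycle_spread (edge_sym out) szc cyc.
exact/tree_g/mem_code.
Qed.

End Ok.
End TableGraph.

(* Entry number 512 i + g lists the neighbours of the vertex g of the fibre over
   the base vertex i. *)
Definition table : seq (seq N) := [::
[:: 857; 1067; 1802];[:: 838; 1204; 1936];[:: 552; 1080; 2005];[:: 842; 1081; 1561];[:: 561; 1341; 1822];[:: 845; 1084; 1628];
[:: 693; 1233; 1762];[:: 848; 1185; 1670];[:: 725; 1343; 1960];[:: 531; 1086; 1766];[:: 698; 1242; 2028];[:: 635; 1113; 1645];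
[:: 768; 1245; 1603];[:: 765; 1056; 1839];[:: 862; 1071; 1649];[:: 796; 1326; 1805];[:: 674; 1124; 2037];[:: 675; 1478; 1782];
[:: 897; 1127; 1607];[:: 639; 1322; 1784];[:: 801; 1125; 1908];[:: 574; 1065; 1719];[:: 664; 1320; 1673];[:: 834; 1062; 1736];
[:: 998; 1079; 1939];[:: 684; 1099; 1658];[:: 685; 1226; 1979];[:: 515; 1136; 1600];[:: 559; 1075; 1661];[:: 811; 1228; 1657];
[:: 622; 1074; 1852];[:: 965; 1329; 1551];[:: 900; 1037; 1742];[:: 868; 1159; 1937];[:: 869; 1078; 1810];[:: 615; 1077; 1684];
[:: 694; 1104; 1891];[:: 775; 1108; 1857];[:: 568; 1047; 1727];[:: 948; 1106; 1633];[:: 631; 1302; 1790];[:: 841; 1045; 1752];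
[:: 648; 1299; 1666];[:: 843; 1024; 1818];[:: 972; 1147; 1563];[:: 752; 1210; 1565];[:: 883; 1295; 1888];[:: 690; 1038; 1823];
[:: 569; 1243; 1643];[:: 828; 1311; 2030];[:: 911; 1054; 1733];[:: 974; 1052; 1540];[:: 849; 1153; 1956];[:: 594; 1059; 1701];
[:: 852; 1058; 1831];[:: 663; 1048; 1770];[:: 982; 1026; 1961];[:: 858; 1027; 1547];[:: 859; 1197; 1548];[:: 925; 1516; 2032];
[:: 672; 1029; 1843];[:: 863; 1284; 1906];[:: 874; 1033; 1943];[:: 937; 1288; 1878];[:: 921; 1131; 1610];[:: 518; 1268; 1616];
[:: 744; 1144; 1557];[:: 906; 1145; 1881];[:: 881; 1533; 2014];[:: 909; 1148; 1564];[:: 885; 1169; 1954];[:: 656; 1249; 1990];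
[:: 789; 1279; 1896];[:: 723; 1150; 1574];[:: 634; 1178; 1836];[:: 699; 1049; 1581];[:: 960; 1181; 1539];[:: 701; 1248; 2031];
[:: 926; 1135; 1841];[:: 860; 1390; 1997];[:: 610; 1060; 1973];[:: 739; 1414; 1974];[:: 961; 1063; 1543];[:: 575; 1386; 1848];
[:: 865; 1061; 1844];[:: 766; 1129; 2039];[:: 728; 1512; 1737];[:: 898; 1126; 1544];[:: 806; 1271; 1875];[:: 748; 1035; 1594];
[:: 621; 1418; 1787];[:: 579; 1456; 1664];[:: 623; 1139; 1725];[:: 1003; 1164; 1593];[:: 686; 1266; 1788];[:: 645; 1137; 1615];
[:: 708; 1229; 1678];[:: 676; 1223; 1745];[:: 805; 1398; 1874];[:: 551; 1269; 1748];[:: 886; 1040; 1955];[:: 839; 1044; 1793];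
[:: 760; 1111; 2047];[:: 1012; 1042; 1569];[:: 823; 1494; 1854];[:: 905; 1109; 1560];[:: 840; 1363; 1858];[:: 907; 1088; 1626];
[:: 908; 1467; 1627];[:: 560; 1274; 1885];[:: 819; 1359; 1824];[:: 754; 1102; 1887];[:: 761; 1051; 1835];[:: 636; 1119; 1710];
[:: 719; 1246; 1925];[:: 910; 1116; 1604];[:: 529; 1217; 1636];[:: 914; 1507; 1893];[:: 532; 1378; 1639];[:: 727; 1240; 1706];
[:: 662; 1090; 1897];[:: 666; 1091; 1867];[:: 539; 1261; 1868];[:: 605; 1068; 1712];[:: 736; 1093; 1907];[:: 671; 1476; 1970];
[:: 682; 1097; 1879];[:: 745; 1224; 1686];[:: 729; 1195; 1674];[:: 966; 1076; 1552];[:: 936; 1208; 1621];[:: 714; 1209; 1689];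
[:: 689; 1213; 1694];[:: 717; 1468; 2012];[:: 565; 1361; 1634];[:: 720; 1057; 1542];[:: 853; 1471; 1576];[:: 915; 1214; 1638];
[:: 826; 1370; 1900];[:: 763; 1241; 2029];[:: 640; 1117; 1731];[:: 637; 1184; 1967];[:: 990; 1199; 1777];[:: 668; 1198; 1677];
[:: 802; 1252; 1653];[:: 803; 1094; 1654];[:: 513; 1255; 1991];[:: 1023; 1194; 1912];[:: 673; 1253; 1780];[:: 702; 1193; 1847];
[:: 536; 1192; 1545];[:: 962; 1446; 1608];[:: 870; 1463; 1555];[:: 812; 1227; 2042];[:: 557; 1098; 1595];[:: 899; 1264; 1728];
[:: 687; 1203; 1789];[:: 683; 1100; 1785];[:: 750; 1202; 1980];[:: 581; 1457; 1679];[:: 516; 1165; 1614];[:: 740; 1031; 1553];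
[:: 741; 1206; 1682];[:: 999; 1205; 1812];[:: 822; 1232; 2019];[:: 647; 1236; 1729];[:: 952; 1431; 1855];[:: 564; 1234; 2017];
[:: 1015; 1174; 1918];[:: 969; 1173; 1624];[:: 520; 1171; 1538];[:: 715; 1152; 1946];[:: 588; 1531; 1691];[:: 624; 1082; 1949];
[:: 1011; 1167; 2016];[:: 562; 1166; 1695];[:: 953; 1371; 1771];[:: 700; 1439; 1646];[:: 527; 1182; 1605];[:: 846; 1180; 1924];
[:: 721; 1025; 1572];[:: 978; 1187; 1829];[:: 724; 1186; 1703];[:: 791; 1432; 1642];[:: 598; 1154; 1833];[:: 730; 1155; 1675];
[:: 731; 1069; 1932];[:: 797; 1388; 1648];[:: 544; 1413; 1971];[:: 991; 1156; 2034];[:: 746; 1161; 1815];[:: 809; 1416; 1750];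
[:: 537; 1259; 1738];[:: 646; 1140; 2000];[:: 872; 1272; 1685];[:: 778; 1273; 2009];[:: 1009; 1405; 1886];[:: 781; 1532; 1692];
[:: 1013; 1297; 1826];[:: 784; 1121; 1862];[:: 917; 1151; 1768];[:: 851; 1278; 1958];[:: 762; 1050; 1964];[:: 571; 1177; 1965];
[:: 576; 1053; 1667];[:: 573; 1120; 1903];[:: 798; 1263; 1713];[:: 988; 1518; 1869];[:: 994; 1188; 1589];[:: 611; 1030; 1590];
[:: 577; 1191; 1927];[:: 959; 1514; 1720];[:: 737; 1189; 1716];[:: 894; 1513; 1655];[:: 856; 1384; 1865];[:: 770; 1254; 1672];
[:: 678; 1143; 1747];[:: 620; 1163; 1978];[:: 749; 1034; 1915];[:: 707; 1072; 1792];[:: 751; 1267; 1597];[:: 619; 1036; 1721];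
[:: 558; 1138; 1916];[:: 773; 1265; 1743];[:: 580; 1101; 1550];[:: 804; 1095; 1873];[:: 677; 1270; 1746];[:: 679; 1397; 1620];
[:: 1014; 1168; 1571];[:: 711; 1172; 1665];[:: 632; 1239; 1919];[:: 628; 1170; 1953];[:: 951; 1366; 1726];[:: 777; 1493; 1688];
[:: 712; 1491; 1730];[:: 523; 1216; 1754];[:: 780; 1339; 1755];[:: 688; 1146; 1757];[:: 947; 1487; 1952];[:: 626; 1230; 2015];
[:: 889; 1179; 1963];[:: 1020; 1247; 1582];[:: 591; 1118; 1541];[:: 782; 1244; 1732];[:: 913; 1089; 2020];[:: 530; 1123; 1765];
[:: 660; 1250; 1767];[:: 599; 1112; 1578];[:: 534; 1218; 2025];[:: 794; 1219; 1995];[:: 667; 1133; 1740];[:: 733; 1452; 1840];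
[:: 864; 1477; 1779];[:: 799; 1348; 1842];[:: 554; 1225; 2007];[:: 617; 1096; 1558];[:: 601; 1323; 1546];[:: 582; 1460; 1680];
[:: 808; 1336; 1749];[:: 586; 1337; 1817];[:: 817; 1085; 1566];[:: 589; 1340; 1884];[:: 949; 1489; 2018];[:: 592; 1441; 1926];
[:: 981; 1087; 1704];[:: 787; 1342; 2022];[:: 954; 1498; 1772];[:: 891; 1369; 1901];[:: 512; 1501; 1859];[:: 1021; 1312; 1583];
[:: 606; 1327; 1905];[:: 540; 1070; 1549];[:: 930; 1380; 1781];[:: 931; 1222; 2038];[:: 641; 1383; 1863];[:: 895; 1066; 2040];
[:: 545; 1381; 1652];[:: 830; 1321; 1975];[:: 920; 1064; 1929];[:: 578; 1318; 1992];[:: 742; 1335; 1683];[:: 940; 1355; 1914];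
[:: 941; 1482; 1723];[:: 771; 1392; 1856];[:: 815; 1331; 1917];[:: 555; 1484; 1913];[:: 878; 1330; 1596];[:: 709; 1073; 1807];
[:: 644; 1293; 1998];[:: 612; 1415; 1681];[:: 613; 1334; 1554];[:: 871; 1333; 1940];[:: 950; 1360; 1635];[:: 519; 1364; 1601];
[:: 824; 1303; 1983];[:: 692; 1362; 1889];[:: 887; 1046; 2046];[:: 585; 1301; 2008];[:: 904; 1043; 1922];[:: 587; 1280; 1562];
[:: 716; 1403; 1819];[:: 1008; 1466; 1821];[:: 627; 1039; 1632];[:: 946; 1294; 1567];[:: 825; 1499; 1899];[:: 572; 1055; 1774];
[:: 655; 1310; 1989];[:: 718; 1308; 1796];[:: 593; 1409; 1700];[:: 850; 1315; 1957];[:: 596; 1314; 1575];[:: 919; 1304; 2026];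
[:: 726; 1282; 1705];[:: 602; 1283; 1803];[:: 603; 1453; 1804];[:: 669; 1260; 1776];[:: 928; 1285; 1587];[:: 607; 1028; 1650];
[:: 618; 1289; 1687];[:: 681; 1032; 1622];[:: 665; 1387; 1866];[:: 774; 1524; 1872];[:: 1000; 1400; 1813];[:: 650; 1401; 1625];
[:: 625; 1277; 1758];[:: 653; 1404; 1820];[:: 629; 1425; 1698];[:: 912; 1505; 1734];[:: 533; 1535; 1640];[:: 979; 1406; 1830];
[:: 890; 1434; 1580];[:: 955; 1305; 1837];[:: 704; 1437; 1795];[:: 957; 1504; 1775];[:: 670; 1391; 1585];[:: 604; 1134; 1741];
[:: 866; 1316; 1717];[:: 995; 1158; 1718];[:: 705; 1319; 1799];[:: 831; 1130; 1592];[:: 609; 1317; 1588];[:: 1022; 1385; 1783];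
[:: 984; 1256; 1993];[:: 642; 1382; 1800];[:: 550; 1527; 1619];[:: 1004; 1291; 1850];[:: 877; 1162; 2043];[:: 835; 1200; 1920];
[:: 879; 1395; 1981];[:: 747; 1420; 1849];[:: 942; 1522; 2044];[:: 901; 1393; 1871];[:: 964; 1485; 1934];[:: 932; 1479; 2001];
[:: 549; 1142; 1618];[:: 807; 1525; 2004];[:: 630; 1296; 1699];[:: 583; 1300; 1537];[:: 1016; 1367; 1791];[:: 756; 1298; 1825];
[:: 567; 1238; 1598];[:: 649; 1365; 1816];[:: 584; 1107; 1602];[:: 651; 1344; 1882];[:: 652; 1211; 1883];[:: 816; 1530; 1629];
[:: 563; 1103; 1568];[:: 1010; 1358; 1631];[:: 1017; 1307; 1579];[:: 892; 1375; 1966];[:: 975; 1502; 1669];[:: 654; 1372; 1860];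
[:: 785; 1473; 1892];[:: 658; 1251; 1637];[:: 788; 1122; 1895];[:: 983; 1496; 1962];[:: 918; 1346; 1641];[:: 922; 1347; 1611];
[:: 795; 1517; 1612];[:: 861; 1324; 1968];[:: 992; 1349; 1651];[:: 927; 1220; 1714];[:: 938; 1353; 1623];[:: 1001; 1480; 1942];
[:: 985; 1451; 1930];[:: 710; 1332; 1808];[:: 680; 1464; 1877];[:: 970; 1465; 1945];[:: 945; 1469; 1950];[:: 973; 1212; 1756];
[:: 821; 1105; 1890];[:: 976; 1313; 1798];[:: 597; 1215; 1832];[:: 659; 1470; 1894];[:: 570; 1114; 1644];[:: 1019; 1497; 1773];
[:: 896; 1373; 1987];[:: 893; 1440; 1711];[:: 734; 1455; 2033];[:: 924; 1454; 1933];[:: 546; 1508; 1909];[:: 547; 1350; 1910];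
[:: 769; 1511; 1735];[:: 767; 1450; 1656];[:: 929; 1509; 2036];[:: 958; 1449; 1591];[:: 792; 1448; 1801];[:: 706; 1190; 1864];
[:: 614; 1207; 1811];[:: 556; 1483; 1786];[:: 813; 1354; 1851];[:: 643; 1520; 1984];[:: 943; 1459; 2045];[:: 939; 1356; 2041];
[:: 1006; 1458; 1724];[:: 837; 1201; 1935];[:: 772; 1421; 1870];[:: 996; 1287; 1809];[:: 997; 1462; 1938];[:: 743; 1461; 1556];
[:: 566; 1488; 1763];[:: 903; 1492; 1985];[:: 696; 1175; 1599];[:: 820; 1490; 1761];[:: 759; 1430; 1662];[:: 713; 1429; 1880];
[:: 776; 1427; 1794];[:: 971; 1408; 1690];[:: 844; 1275; 1947];[:: 880; 1338; 1693];[:: 755; 1423; 1760];[:: 818; 1422; 1951];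
[:: 697; 1115; 2027];[:: 956; 1183; 1902];[:: 783; 1438; 1861];[:: 590; 1436; 1668];[:: 977; 1281; 1828];[:: 722; 1443; 1573];
[:: 980; 1442; 1959];[:: 535; 1176; 1898];[:: 854; 1410; 1577];[:: 986; 1411; 1931];[:: 987; 1325; 1676];[:: 541; 1132; 1904];
[:: 800; 1157; 1715];[:: 735; 1412; 1778];[:: 1002; 1417; 1559];[:: 553; 1160; 2006];[:: 793; 1515; 1994];[:: 902; 1396; 1744];
[:: 616; 1528; 1941];[:: 522; 1529; 1753];[:: 753; 1149; 1630];[:: 525; 1276; 1948];[:: 757; 1041; 1570];[:: 528; 1377; 1606];
[:: 661; 1407; 2024];[:: 595; 1534; 1702];[:: 1018; 1306; 1708];[:: 827; 1433; 1709];[:: 832; 1309; 1923];[:: 829; 1376; 1647];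
[:: 542; 1519; 1969];[:: 732; 1262; 1613];[:: 738; 1444; 1845];[:: 867; 1286; 1846];[:: 833; 1447; 1671];[:: 703; 1258; 1976];
[:: 993; 1445; 1972];[:: 638; 1257; 1911];[:: 600; 1128; 1609];[:: 514; 1510; 1928];[:: 934; 1399; 2003];[:: 876; 1419; 1722];
[:: 1005; 1290; 1659];[:: 963; 1328; 1536];[:: 1007; 1523; 1853];[:: 875; 1292; 1977];[:: 814; 1394; 1660];[:: 517; 1521; 1999];
[:: 836; 1357; 1806];[:: 548; 1351; 1617];[:: 933; 1526; 2002];[:: 935; 1141; 1876];[:: 758; 1424; 1827];[:: 967; 1428; 1921];
[:: 888; 1495; 1663];[:: 884; 1426; 1697];[:: 695; 1110; 1982];[:: 521; 1237; 1944];[:: 968; 1235; 1986];[:: 779; 1472; 2010];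
[:: 524; 1083; 2011];[:: 944; 1402; 2013];[:: 691; 1231; 1696];[:: 882; 1486; 1759];[:: 633; 1435; 1707];[:: 764; 1503; 1838];
[:: 847; 1374; 1797];[:: 526; 1500; 1988];[:: 657; 1345; 1764];[:: 786; 1379; 2021];[:: 916; 1506; 2023];[:: 855; 1368; 1834];
[:: 790; 1474; 1769];[:: 538; 1475; 1739];[:: 923; 1389; 1996];[:: 989; 1196; 1584];[:: 608; 1221; 2035];[:: 543; 1092; 1586];
[:: 810; 1481; 1751];[:: 873; 1352; 1814];[:: 268; 804; 1794];[:: 146; 779; 1604];[:: 471; 563; 1990];[:: 27; 913; 1736];
[:: 160; 919; 1674];[:: 479; 790; 1547];[:: 65; 953; 1933];[:: 293; 538; 1870];[:: 170; 928; 1552];[:: 489; 543; 1745];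
[:: 451; 545; 1811];[:: 235; 769; 1685];[:: 492; 675; 2006];[:: 453; 767; 1792];[:: 499; 810; 1561];[:: 178; 937; 1946];
[:: 455; 811; 1628];[:: 116; 899; 1950];[:: 245; 813; 1695];[:: 9; 879; 1537];[:: 118; 812; 1760];[:: 328; 1006; 1825];
[:: 248; 773; 1762];[:: 439; 644; 2019];[:: 150; 946; 1572];[:: 192; 820; 1958];[:: 505; 519; 1832];[:: 122; 950; 1769];
[:: 271; 1016; 1603];[:: 443; 693; 1898];[:: 462; 759; 1835];[:: 509; 521; 1708];[:: 188; 904; 2029];[:: 276; 522; 1861];
[:: 400; 944; 1774];[:: 401; 908; 1775];[:: 481; 768; 1649];[:: 354; 763; 1778];[:: 344; 893; 1799];[:: 99; 826; 1971];
[:: 2; 892; 1588];[:: 447; 655; 1653];[:: 254; 782; 1782];[:: 285; 784; 1801];[:: 409; 788; 2039];[:: 154; 786; 1976];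
[:: 222; 853; 1804];[:: 28; 979; 1968];[:: 109; 930; 1751];[:: 4; 766; 1913];[:: 175; 920; 2042];[:: 366; 514; 1659];
[:: 167; 793; 1615];[:: 134; 925; 2044];[:: 420; 923; 1661];[:: 360; 734; 1554];[:: 38; 988; 1620];[:: 48; 646; 1752];
[:: 394; 807; 1982];[:: 203; 997; 1727];[:: 305; 1000; 1947];[:: 205; 870; 1821];[:: 21; 1009; 1637];[:: 83; 973; 1831];
[:: 204; 996; 1858];[:: 210; 715; 1796];[:: 279; 627; 1926];[:: 91; 593; 1544];[:: 224; 855; 1738];[:: 159; 854; 1739];
[:: 257; 633; 1869];[:: 357; 602; 1550];[:: 362; 992; 1744];[:: 297; 607; 1681];[:: 259; 609; 1747];[:: 299; 961; 1749];
[:: 172; 867; 1558];[:: 261; 959; 1984];[:: 435; 1002; 1753];[:: 242; 873; 1754];[:: 263; 747; 1948];[:: 308; 579; 1886];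
[:: 53; 1005; 1759];[:: 457; 687; 1729];[:: 310; 1004; 1952];[:: 392; 814; 1761];[:: 184; 837; 1954];[:: 247; 836; 1827];
[:: 470; 1010; 1764];[:: 256; 1012; 2022];[:: 313; 583; 1768];[:: 314; 886; 1705];[:: 335; 952; 1923];[:: 123; 1013; 1578];
[:: 270; 951; 2027];[:: 317; 585; 1644];[:: 508; 968; 1581];[:: 340; 586; 1541];[:: 80; 1008; 1966];[:: 209; 844; 1967];
[:: 289; 704; 1969];[:: 290; 955; 1970];[:: 408; 829; 1735];[:: 35; 1018; 1779];[:: 450; 700; 1780];[:: 255; 847; 1845];
[:: 318; 718; 1590];[:: 221; 976; 1865];[:: 217; 980; 1719];[:: 90; 722; 1656];[:: 30; 917; 1740];[:: 92; 787; 1776];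
[:: 173; 994; 1815];[:: 324; 958; 1977];[:: 239; 984; 1594];[:: 302; 578; 1595];[:: 231; 729; 1807];[:: 326; 733; 1852];
[:: 356; 859; 1725];[:: 40; 670; 1746];[:: 230; 924; 1812];[:: 496; 582; 1560];[:: 74; 743; 1662];[:: 11; 677; 1919];
[:: 113; 808; 1883];[:: 141; 806; 1885];[:: 469; 945; 1829];[:: 19; 653; 1767];[:: 140; 676; 1922];[:: 274; 651; 1732];
[:: 343; 691; 1862];[:: 411; 785; 1864];[:: 288; 535; 1546];[:: 95; 662; 1675];[:: 193; 569; 1805];[:: 165; 666; 1998];
[:: 42; 800; 1936];[:: 361; 927; 1873];[:: 323; 929; 1939];[:: 363; 641; 1813];[:: 364; 803; 1878];[:: 325; 639; 1920];
[:: 371; 938; 1945];[:: 306; 553; 1562];[:: 71; 683; 2012];[:: 500; 771; 1566];[:: 373; 685; 1567];[:: 393; 751; 1921];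
[:: 246; 684; 1888];[:: 456; 878; 1953];[:: 120; 645; 1634];[:: 55; 772; 1635];[:: 22; 818; 1956];[:: 320; 692; 1830];
[:: 121; 647; 1704];[:: 250; 822; 1641];[:: 143; 888; 1987];[:: 315; 821; 2026];[:: 334; 631; 1963];[:: 125; 905; 1836];
[:: 60; 776; 1901];[:: 148; 906; 1989];[:: 16; 816; 1646];[:: 17; 524; 1647];[:: 97; 640; 2033];[:: 226; 635; 1906];
[:: 216; 765; 1671];[:: 227; 698; 1587];[:: 386; 1020; 1972];[:: 319; 783; 1781];[:: 126; 910; 1910];[:: 157; 656; 1929];
[:: 25; 660; 1911];[:: 26; 658; 1848];[:: 94; 725; 1676];[:: 156; 595; 1840];[:: 237; 802; 1623];[:: 132; 894; 2041];
[:: 47; 792; 1914];[:: 494; 642; 2043];[:: 295; 665; 1743];[:: 6; 541; 1660];[:: 36; 795; 1789];[:: 488; 862; 1682];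
[:: 422; 860; 2004];[:: 432; 774; 1880];[:: 10; 679; 1854];[:: 75; 869; 1855];[:: 177; 616; 1819];[:: 77; 998; 1693];
[:: 149; 881; 2021];[:: 467; 845; 1703];[:: 332; 612; 1986];[:: 338; 843; 1668];[:: 407; 755; 1798];[:: 219; 721; 1928];
[:: 96; 983; 1610];[:: 287; 726; 1867];[:: 385; 1017; 1997];[:: 229; 730; 1678];[:: 234; 864; 1872];[:: 425; 735; 1809];
[:: 131; 737; 1875];[:: 171; 577; 1621];[:: 300; 995; 1942];[:: 133; 831; 1856];[:: 307; 618; 1881];[:: 114; 1001; 1626];
[:: 135; 875; 1564];[:: 180; 707; 1758];[:: 437; 621; 1887];[:: 73; 815; 1857];[:: 182; 876; 1568];[:: 8; 686; 1889];
[:: 312; 709; 1570];[:: 119; 964; 1955];[:: 86; 882; 1892];[:: 128; 628; 1638];[:: 185; 711; 1896];[:: 186; 1014; 1833];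
[:: 463; 824; 1539];[:: 251; 629; 1962];[:: 398; 567; 1899];[:: 445; 713; 2028];[:: 124; 840; 1709];[:: 212; 714; 1925];
[:: 464; 880; 1838];[:: 81; 972; 1583];[:: 161; 832; 1841];[:: 162; 827; 1586];[:: 280; 957; 1607];[:: 419; 634; 1907];
[:: 66; 828; 1908];[:: 127; 975; 1973];[:: 190; 846; 1974];[:: 349; 592; 1993];[:: 89; 852; 1591];[:: 218; 850; 1784];
[:: 158; 789; 1868];[:: 220; 659; 1648];[:: 45; 866; 1943];[:: 452; 830; 1593];[:: 111; 856; 1722];[:: 430; 706; 1979];
[:: 359; 857; 1679];[:: 454; 861; 1980];[:: 484; 987; 1853];[:: 424; 542; 1874];[:: 102; 796; 1684];[:: 112; 966; 1944];
[:: 202; 871; 1790];[:: 139; 549; 1791];[:: 497; 936; 2011];[:: 13; 678; 1757];[:: 85; 561; 1701];[:: 403; 525; 1895];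
[:: 12; 548; 1538];[:: 402; 523; 1860];[:: 215; 819; 1734];[:: 283; 657; 1992];[:: 416; 663; 1930];[:: 223; 534; 1803];
[:: 321; 697; 1677];[:: 37; 794; 1614];[:: 426; 672; 1808];[:: 233; 799; 2001];[:: 195; 801; 1555];[:: 491; 513; 1941];
[:: 236; 931; 1750];[:: 197; 1023; 1536];[:: 243; 554; 1817];[:: 434; 681; 1690];[:: 199; 555; 1884];[:: 372; 643; 1694];
[:: 501; 557; 1951];[:: 265; 623; 1793];[:: 374; 556; 2016];[:: 72; 750; 1569];[:: 504; 517; 2018];[:: 183; 900; 1763];
[:: 406; 690; 1828];[:: 448; 564; 1702];[:: 249; 775; 1576];[:: 378; 694; 2025];[:: 15; 760; 1859];[:: 187; 949; 1642];
[:: 206; 1015; 1579];[:: 253; 777; 1964];[:: 444; 648; 1773];[:: 20; 778; 1605];[:: 144; 688; 2030];[:: 145; 652; 2031];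
[:: 225; 512; 1905];[:: 98; 1019; 2034];[:: 88; 637; 1543];[:: 355; 570; 1715];[:: 258; 636; 1844];[:: 191; 911; 1909];
[:: 510; 526; 2038];[:: 29; 528; 1545];[:: 153; 532; 1783];[:: 410; 530; 1720];[:: 478; 597; 1548];[:: 284; 723; 1712];
[:: 365; 674; 2007];[:: 260; 1022; 1657];[:: 431; 664; 1786];[:: 110; 770; 1915];[:: 423; 537; 1871];[:: 390; 669; 1788];
[:: 164; 667; 1917];[:: 104; 990; 1810];[:: 294; 732; 1876];[:: 304; 902; 2008];[:: 138; 551; 1726];[:: 459; 741; 1983];
[:: 49; 744; 1691];[:: 461; 614; 1565];[:: 277; 753; 1893];[:: 339; 717; 1575];[:: 460; 740; 1602];[:: 466; 971; 1540];
[:: 23; 883; 1670];[:: 347; 849; 1800];[:: 480; 599; 1994];[:: 415; 598; 1995];[:: 1; 889; 1613];[:: 101; 858; 1806];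
[:: 106; 736; 2000];[:: 41; 863; 1937];[:: 3; 865; 2003];[:: 43; 705; 2005];[:: 428; 611; 1814];[:: 5; 703; 1728];
[:: 179; 746; 2009];[:: 498; 617; 2010];[:: 7; 1003; 1692];[:: 52; 835; 1630];[:: 309; 749; 2015];[:: 201; 943; 1985];
[:: 54; 748; 1696];[:: 136; 558; 2017];[:: 440; 581; 1698];[:: 503; 580; 1571];[:: 214; 754; 2020];[:: 0; 756; 1766];
[:: 57; 839; 2024];[:: 58; 630; 1961];[:: 79; 696; 1667];[:: 379; 757; 1834];[:: 14; 695; 1771];[:: 61; 841; 1900];
[:: 252; 712; 1837];[:: 84; 842; 1797];[:: 336; 752; 1710];[:: 465; 588; 1711];[:: 33; 960; 1713];[:: 34; 699; 1714];
[:: 152; 573; 1991];[:: 291; 762; 2035];[:: 194; 956; 2036];[:: 511; 591; 1589];[:: 62; 974; 1846];[:: 477; 720; 1609];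
[:: 473; 724; 1975];[:: 346; 978; 1912];[:: 286; 661; 1996];[:: 348; 531; 2032];[:: 429; 738; 1559];[:: 68; 702; 1721];
[:: 495; 728; 1850];[:: 46; 834; 1851];[:: 487; 985; 1551];[:: 70; 989; 1596];[:: 100; 603; 1981];[:: 296; 926; 2002];
[:: 486; 668; 1556];[:: 240; 838; 1816];[:: 330; 999; 1918];[:: 267; 933; 1663];[:: 369; 552; 1627];[:: 397; 550; 1629];
[:: 213; 689; 1573];[:: 275; 909; 2023];[:: 396; 932; 1666];[:: 18; 907; 1988];[:: 87; 947; 1606];[:: 155; 529; 1608];
[:: 32; 791; 1802];[:: 351; 918; 1931];[:: 449; 825; 1549];[:: 421; 922; 1742];[:: 298; 544; 1680];[:: 105; 671; 1617];
[:: 67; 673; 1683];[:: 107; 897; 1557];[:: 108; 547; 1622];[:: 69; 895; 1664];[:: 115; 682; 1689];[:: 50; 809; 1818];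
[:: 327; 939; 1756];[:: 244; 515; 1822];[:: 117; 941; 1823];[:: 137; 1007; 1665];[:: 502; 940; 1632];[:: 200; 622; 1697];
[:: 376; 901; 1890];[:: 311; 516; 1891];[:: 278; 562; 1700];[:: 64; 948; 1574];[:: 377; 903; 1960];[:: 506; 566; 1897];
[:: 399; 632; 1731];[:: 59; 565; 1770];[:: 78; 887; 1707];[:: 381; 649; 1580];[:: 316; 520; 1645];[:: 404; 650; 1733];
[:: 272; 560; 1902];[:: 273; 780; 1903];[:: 353; 896; 1777];[:: 482; 891; 1650];[:: 472; 1021; 1927];[:: 483; 954; 1843];
[:: 130; 764; 1716];[:: 63; 527; 2037];[:: 382; 654; 1654];[:: 413; 912; 1673];[:: 281; 916; 1655];[:: 282; 914; 1592];
[:: 350; 981; 1932];[:: 412; 851; 1584];[:: 493; 546; 1879];[:: 388; 638; 1785];[:: 303; 536; 1658];[:: 238; 898; 1787];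
[:: 39; 921; 1999];[:: 262; 797; 1916];[:: 292; 539; 2045];[:: 232; 606; 1938];[:: 166; 604; 1748];[:: 176; 518; 1624];
[:: 266; 935; 1598];[:: 331; 613; 1599];[:: 433; 872; 1563];[:: 333; 742; 1949];[:: 405; 625; 1765];[:: 211; 589; 1959];
[:: 76; 868; 1730];[:: 82; 587; 1924];[:: 151; 1011; 1542];[:: 475; 977; 1672];[:: 352; 727; 1866];[:: 31; 982; 1611];
[:: 129; 761; 1741];[:: 485; 986; 1934];[:: 490; 608; 1616];[:: 169; 991; 1553];[:: 387; 993; 1619];[:: 427; 833; 1877];
[:: 44; 739; 1686];[:: 389; 575; 1600];[:: 51; 874; 1625];[:: 370; 745; 1882];[:: 391; 619; 1820];[:: 436; 963; 2014];
[:: 181; 877; 1631];[:: 329; 559; 1601];[:: 438; 620; 1824];[:: 264; 942; 1633];[:: 56; 965; 1826];[:: 375; 708; 1699];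
[:: 342; 626; 1636];[:: 384; 884; 1894];[:: 441; 967; 1640];[:: 442; 758; 1577];[:: 207; 568; 1795];[:: 507; 885; 1706];
[:: 142; 823; 1643];[:: 189; 969; 1772];[:: 380; 584; 1965];[:: 468; 970; 1669];[:: 208; 624; 1582];[:: 337; 716; 1839];
[:: 417; 576; 1585];[:: 418; 571; 1842];[:: 24; 701; 1863];[:: 163; 890; 1651];[:: 322; 572; 1652];[:: 383; 719; 1717];
[:: 446; 590; 1718];[:: 93; 848; 1737];[:: 345; 596; 1847];[:: 474; 594; 2040];[:: 414; 533; 1612];[:: 476; 915; 1904];
[:: 301; 610; 1687];[:: 196; 574; 1849];[:: 367; 600; 1978];[:: 174; 962; 1723];[:: 103; 601; 1935];[:: 198; 605; 1724];
[:: 228; 731; 1597];[:: 168; 798; 1618];[:: 358; 540; 1940];[:: 368; 710; 1688];[:: 458; 615; 2046];[:: 395; 805; 2047];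
[:: 241; 680; 1755];[:: 269; 934; 2013];[:: 341; 817; 1957];[:: 147; 781; 1639];[:: 43; 1069; 1756];[:: 180; 1334; 1958];
[:: 56; 1353; 1923];[:: 57; 1275; 1677];[:: 317; 1359; 1863];[:: 60; 1358; 2036];[:: 209; 1492; 1544];[:: 161; 1315; 1555];
[:: 319; 1368; 1728];[:: 62; 1346; 1977];[:: 218; 1501; 1806];[:: 89; 1499; 1807];[:: 221; 1370; 1724];[:: 32; 1182; 1552];
[:: 47; 1349; 1985];[:: 302; 1348; 1889];[:: 100; 1127; 1602];[:: 454; 1509; 1560];[:: 103; 1508; 1662];[:: 298; 1064; 1689];
[:: 101; 1478; 1983];[:: 41; 1062; 1946];[:: 296; 1194; 2011];[:: 38; 1193; 1757];[:: 55; 1352; 1771];[:: 75; 1392; 1796];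
[:: 202; 1484; 1797];[:: 112; 1227; 1966];[:: 51; 1201; 1606];[:: 204; 1354; 1711];[:: 50; 1165; 1572];[:: 305; 1075; 1829];
[:: 13; 1074; 2023];[:: 135; 1333; 1576];[:: 54; 1332; 1769];[:: 53; 1287; 1642];[:: 80; 1106; 1609];[:: 84; 1233; 1975];
[:: 23; 1045; 1674];[:: 82; 1488; 1656];[:: 278; 1043; 1675];[:: 21; 1175; 1740];[:: 275; 1174; 1904];[:: 0; 1082; 1777];
[:: 123; 1337; 1778];[:: 186; 1024; 1971];[:: 271; 1405; 1909];[:: 14; 1276; 1910];[:: 219; 1241; 1981];[:: 287; 1436; 1873];
[:: 30; 1056; 2002];[:: 28; 1055; 1812];[:: 129; 1314; 1685];[:: 35; 1313; 1750];[:: 34; 1281; 1751];[:: 24; 1407; 2042];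
[:: 2; 1534; 1787];[:: 3; 1324; 1694];[:: 173; 1067; 1695];[:: 492; 1347; 1568];[:: 5; 1519; 1634];[:: 260; 1518; 1763];
[:: 9; 1528; 1836];[:: 264; 1143; 1773];[:: 107; 1517; 1692];[:: 244; 1142; 1894];[:: 120; 1289; 1603];[:: 121; 1339; 1741];
[:: 509; 1295; 1543];[:: 124; 1294; 1716];[:: 145; 1172; 1608];[:: 225; 1379; 2003];[:: 255; 1304; 1664];[:: 126; 1282; 1657];
[:: 154; 1309; 1614];[:: 25; 1435; 1743];[:: 157; 1178; 1660];[:: 224; 1246; 1872];[:: 111; 1285; 1665];[:: 366; 1284; 1569];
[:: 36; 1447; 1922];[:: 390; 1189; 1624];[:: 39; 1060; 1854];[:: 362; 1128; 1753];[:: 37; 1158; 1919];[:: 105; 1126; 1626];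
[:: 488; 1386; 1563];[:: 102; 1257; 1693];[:: 247; 1288; 1707];[:: 11; 1456; 1732];[:: 394; 1292; 1605];[:: 432; 1419; 1902];
[:: 115; 1265; 1542];[:: 140; 1418; 1647];[:: 242; 1229; 1892];[:: 113; 1139; 1637];[:: 205; 1138; 1703];[:: 199; 1525; 2024];
[:: 374; 1396; 1833];[:: 245; 1351; 1706];[:: 16; 1426; 1929];[:: 20; 1425; 1911];[:: 87; 1109; 1610];[:: 18; 1040; 1848];
[:: 470; 1107; 1739];[:: 85; 1239; 1676];[:: 339; 1366; 1968];[:: 64; 1530; 1713];[:: 443; 1401; 1586];[:: 250; 1472; 1651];
[:: 335; 1469; 1717];[:: 78; 1468; 1846];[:: 27; 1305; 1661];[:: 95; 1244; 1553];[:: 222; 1120; 1682];[:: 92; 1119; 1620];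
[:: 193; 1378; 1877];[:: 483; 1505; 1558];[:: 354; 1089; 1559];[:: 216; 1087; 1722];[:: 66; 1470; 1723];[:: 67; 1388; 1758];
[:: 237; 1515; 1631];[:: 44; 1155; 1632];[:: 69; 1455; 1826];[:: 452; 1326; 1571];[:: 73; 1464; 1772];[:: 200; 1335; 1709];
[:: 171; 1197; 1628];[:: 52; 1462; 1574];[:: 184; 1481; 1539];[:: 185; 1147; 1805];[:: 189; 1231; 1735];[:: 444; 1230; 1652];
[:: 337; 1108; 1672];[:: 33; 1443; 1939];[:: 447; 1496; 1600];[:: 190; 1474; 1593];[:: 346; 1373; 1678];[:: 217; 1371; 1935];
[:: 93; 1242; 1852];[:: 160; 1054; 1936];[:: 175; 1477; 1857];[:: 174; 1220; 1761];[:: 228; 1255; 1986];[:: 70; 1381; 1944];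
[:: 231; 1380; 2046];[:: 170; 1192; 1561];[:: 229; 1094; 1599];[:: 169; 1446; 1818];[:: 168; 1066; 1627];[:: 422; 1065; 1885];
[:: 439; 1480; 1643];[:: 203; 1264; 1924];[:: 74; 1100; 1669];[:: 240; 1355; 1838];[:: 179; 1329; 1734];[:: 76; 1226; 1839];
[:: 178; 1037; 1956];[:: 433; 1459; 1957];[:: 141; 1202; 1639];[:: 7; 1461; 1960];[:: 182; 1460; 1641];[:: 181; 1415; 2026];
[:: 208; 1234; 1993];[:: 212; 1105; 1847];[:: 407; 1429; 1546];[:: 210; 1360; 2040];[:: 150; 1171; 1547];[:: 149; 1047; 1868];
[:: 147; 1046; 2032];[:: 128; 1210; 1649];[:: 507; 1209; 1650];[:: 58; 1152; 1843];[:: 143; 1533; 2037];[:: 142; 1404; 1782];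
[:: 347; 1369; 1853];[:: 415; 1052; 2001];[:: 158; 1184; 1618];[:: 156; 1439; 1684];[:: 1; 1442; 1557];[:: 163; 1441; 1878];
[:: 162; 1409; 1623];[:: 408; 1279; 1658];[:: 130; 1406; 1915];[:: 131; 1196; 1822];[:: 45; 1195; 1823];[:: 364; 1475; 1952];
[:: 389; 1391; 1762];[:: 132; 1390; 1891];[:: 137; 1400; 1964];[:: 392; 1271; 1645];[:: 235; 1389; 1564];[:: 116; 1526; 2022];
[:: 248; 1417; 1987];[:: 249; 1467; 1869];[:: 381; 1167; 1671];[:: 508; 1422; 1588];[:: 273; 1300; 1736];[:: 97; 1251; 1619];
[:: 127; 1432; 1536];[:: 254; 1410; 2041];[:: 26; 1181; 1742];[:: 153; 1051; 1871];[:: 29; 1306; 1788];[:: 96; 1118; 1744];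
[:: 239; 1157; 1537];[:: 494; 1156; 1697];[:: 164; 1319; 1538];[:: 6; 1061; 2008];[:: 167; 1188; 1726];[:: 490; 1256; 1625];
[:: 165; 1286; 1791];[:: 489; 1510; 2010];[:: 360; 1514; 1947];[:: 230; 1129; 1821];[:: 119; 1416; 1579];[:: 139; 1072; 1860];
[:: 10; 1164; 1733];[:: 48; 1291; 1774];[:: 243; 1137; 1670];[:: 12; 1290; 2031];[:: 114; 1101; 1764];[:: 241; 1267; 2021];
[:: 77; 1266; 1831];[:: 71; 1397; 1640];[:: 246; 1524; 1961];[:: 373; 1223; 1834];[:: 144; 1298; 1545];[:: 148; 1297; 1783];
[:: 215; 1493; 1738];[:: 146; 1168; 1720];[:: 342; 1235; 1611];[:: 469; 1111; 1804];[:: 467; 1494; 1584];[:: 192; 1402; 1841];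
[:: 315; 1529; 1970];[:: 122; 1344; 1779];[:: 463; 1341; 1589];[:: 206; 1340; 1974];[:: 155; 1177; 1789];[:: 223; 1116; 1937];
[:: 94; 1248; 1810];[:: 220; 1247; 2004];[:: 65; 1506; 1749];[:: 99; 1377; 1686];[:: 226; 1473; 1943];[:: 88; 1215; 1594];
[:: 194; 1342; 1851];[:: 195; 1516; 1886];[:: 109; 1387; 1759];[:: 428; 1027; 2016];[:: 453; 1071; 1698];[:: 324; 1454; 1699];
[:: 201; 1336; 1900];[:: 72; 1207; 1581];[:: 299; 1325; 2012];[:: 436; 1078; 1702];[:: 312; 1097; 1667];[:: 313; 1531; 1933];
[:: 61; 1103; 1607];[:: 316; 1102; 1780];[:: 465; 1236; 1800];[:: 417; 1059; 1811];[:: 63; 1112; 1984];[:: 318; 1090; 1721];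
[:: 474; 1245; 1550];[:: 345; 1243; 1551];[:: 477; 1114; 1980];[:: 288; 1438; 1808];[:: 303; 1093; 1729];[:: 46; 1092; 1633];
[:: 356; 1383; 1858];[:: 198; 1253; 1816];[:: 359; 1252; 1918];[:: 42; 1320; 1945];[:: 357; 1222; 1727];[:: 297; 1318; 1690];
[:: 40; 1450; 1755];[:: 294; 1449; 2013];[:: 311; 1096; 2027];[:: 331; 1136; 1540];[:: 458; 1228; 1541];[:: 368; 1483; 1710];
[:: 307; 1457; 1862];[:: 460; 1098; 1967];[:: 306; 1421; 1828];[:: 49; 1331; 1573];[:: 269; 1330; 1767];[:: 391; 1077; 1832];
[:: 310; 1076; 2025];[:: 309; 1031; 1898];[:: 336; 1362; 1865];[:: 340; 1489; 1719];[:: 279; 1301; 1930];[:: 338; 1232; 1912];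
[:: 22; 1299; 1931];[:: 277; 1431; 1996];[:: 19; 1430; 1648];[:: 256; 1338; 2033];[:: 379; 1081; 2034];[:: 442; 1280; 1715];
[:: 15; 1149; 1653];[:: 270; 1532; 1654];[:: 475; 1497; 1725];[:: 31; 1180; 1617];[:: 286; 1312; 1746];[:: 284; 1311; 1556];
[:: 385; 1058; 1941];[:: 291; 1057; 2006];[:: 290; 1025; 2007];[:: 280; 1151; 1786];[:: 258; 1278; 2043];[:: 259; 1068; 1950];
[:: 429; 1323; 1951];[:: 236; 1091; 1824];[:: 261; 1263; 1890];[:: 4; 1262; 2019];[:: 265; 1272; 1580];[:: 8; 1399; 2029];
[:: 363; 1261; 1948];[:: 500; 1398; 1638];[:: 376; 1033; 1859];[:: 377; 1083; 1997];[:: 253; 1039; 1799];[:: 380; 1038; 1972];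
[:: 401; 1428; 1864];[:: 481; 1123; 1747];[:: 511; 1048; 1920];[:: 382; 1026; 1913];[:: 410; 1053; 1870];[:: 281; 1179; 1999];
[:: 413; 1434; 1916];[:: 480; 1502; 1616];[:: 367; 1029; 1921];[:: 110; 1028; 1825];[:: 292; 1191; 1666];[:: 134; 1445; 1880];
[:: 295; 1316; 1598];[:: 106; 1384; 2009];[:: 293; 1414; 1663];[:: 361; 1382; 1882];[:: 232; 1130; 1819];[:: 358; 1513; 1949];
[:: 503; 1032; 1963];[:: 267; 1200; 1988];[:: 138; 1036; 1861];[:: 176; 1163; 1646];[:: 371; 1521; 1798];[:: 396; 1162; 1903];
[:: 498; 1485; 1636];[:: 369; 1395; 1893];[:: 461; 1394; 1959];[:: 455; 1269; 1768];[:: 118; 1140; 1577];[:: 501; 1095; 1962];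
[:: 272; 1170; 1673];[:: 276; 1169; 1655];[:: 343; 1365; 1866];[:: 274; 1296; 1592];[:: 214; 1363; 1995];[:: 341; 1495; 1932];
[:: 83; 1110; 1712];[:: 320; 1274; 1969];[:: 187; 1145; 1842];[:: 506; 1216; 1907];[:: 79; 1213; 1973];[:: 334; 1212; 1590];
[:: 283; 1049; 1917];[:: 351; 1500; 1809];[:: 478; 1376; 1938];[:: 348; 1375; 1876];[:: 449; 1122; 1621];[:: 227; 1249; 1814];
[:: 98; 1345; 1815];[:: 472; 1343; 1978];[:: 322; 1214; 1979];[:: 323; 1132; 2014];[:: 493; 1259; 1887];[:: 300; 1411; 1888];
[:: 325; 1199; 1570];[:: 196; 1070; 1827];[:: 329; 1208; 2028];[:: 456; 1079; 1965];[:: 427; 1453; 1884];[:: 308; 1206; 1830];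
[:: 440; 1225; 1795];[:: 441; 1403; 1549];[:: 445; 1487; 1991];[:: 188; 1486; 1908];[:: 81; 1364; 1928];[:: 289; 1187; 1683];
[:: 191; 1240; 1856];[:: 446; 1218; 1849];[:: 90; 1117; 1934];[:: 473; 1115; 1679];[:: 349; 1498; 1596];[:: 416; 1310; 1680];
[:: 431; 1221; 1601];[:: 430; 1476; 2017];[:: 484; 1511; 1730];[:: 326; 1125; 1688];[:: 487; 1124; 1790];[:: 426; 1448; 1817];
[:: 485; 1350; 1855];[:: 425; 1190; 1562];[:: 424; 1322; 1883];[:: 166; 1321; 1629];[:: 183; 1224; 1899];[:: 459; 1520; 1668];
[:: 330; 1356; 1925];[:: 496; 1099; 1582];[:: 435; 1073; 1990];[:: 332; 1482; 1583];[:: 434; 1293; 1700];[:: 177; 1203; 1701];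
[:: 397; 1458; 1895];[:: 263; 1205; 1704];[:: 438; 1204; 1897];[:: 437; 1159; 1770];[:: 464; 1490; 1737];[:: 468; 1361; 1591];
[:: 151; 1173; 1802];[:: 466; 1104; 1784];[:: 406; 1427; 1803];[:: 405; 1303; 1612];[:: 403; 1302; 1776];[:: 384; 1466; 1905];
[:: 251; 1465; 1906];[:: 314; 1408; 1587];[:: 399; 1277; 1781];[:: 398; 1148; 2038];[:: 91; 1113; 1597];[:: 159; 1308; 1745];
[:: 414; 1440; 1874];[:: 412; 1183; 1940];[:: 257; 1186; 1813];[:: 419; 1185; 1622];[:: 418; 1153; 1879];[:: 152; 1535; 1914];
[:: 386; 1150; 1659];[:: 387; 1452; 1566];[:: 301; 1451; 1567];[:: 108; 1219; 1696];[:: 133; 1135; 2018];[:: 388; 1134; 1635];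
[:: 393; 1144; 1708];[:: 136; 1527; 1901];[:: 491; 1133; 1820];[:: 372; 1270; 1766];[:: 504; 1161; 1731];[:: 505; 1211; 1613];
[:: 125; 1423; 1927];[:: 252; 1166; 1844];[:: 17; 1044; 1992];[:: 353; 1507; 1875];[:: 383; 1176; 1792];[:: 510; 1154; 1785];
[:: 282; 1437; 1998];[:: 409; 1307; 1615];[:: 285; 1050; 2044];[:: 352; 1374; 2000];[:: 495; 1413; 1793];[:: 238; 1412; 1953];
[:: 420; 1063; 1794];[:: 262; 1317; 1752];[:: 423; 1444; 1982];[:: 234; 1512; 1881];[:: 421; 1030; 2047];[:: 233; 1254; 1754];
[:: 104; 1258; 1691];[:: 486; 1385; 1565];[:: 375; 1160; 1835];[:: 395; 1328; 1604];[:: 266; 1420; 1989];[:: 304; 1035; 2030];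
[:: 499; 1393; 1926];[:: 268; 1034; 1775];[:: 370; 1357; 2020];[:: 497; 1523; 1765];[:: 333; 1522; 1575];[:: 327; 1141; 1896];
[:: 502; 1268; 1705];[:: 117; 1479; 1578];[:: 400; 1042; 1801];[:: 404; 1041; 2039];[:: 471; 1237; 1994];[:: 402; 1424; 1976];
[:: 86; 1491; 1867];[:: 213; 1367; 1548];[:: 211; 1238; 1840];[:: 448; 1146; 1585];[:: 59; 1273; 1714];[:: 378; 1088; 2035];
[:: 207; 1085; 1845];[:: 462; 1084; 1718];[:: 411; 1433; 2045];[:: 479; 1372; 1681];[:: 350; 1504; 1554];[:: 476; 1503; 1748];
[:: 321; 1250; 2005];[:: 355; 1121; 1942];[:: 482; 1217; 1687];[:: 344; 1471; 1850];[:: 450; 1086; 1595];[:: 451; 1260; 1630];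
[:: 365; 1131; 2015];[:: 172; 1283; 1760];[:: 197; 1327; 1954];[:: 68; 1198; 1955];[:: 457; 1080; 1644];[:: 328; 1463; 1837];
[:: 475; 781; 1224];[:: 357; 531; 1230];[:: 170; 768; 1232];[:: 76; 732; 1154];[:: 51; 833; 1305];[:: 242; 609; 1306];
[:: 135; 962; 1116];[:: 82; 806; 1092];[:: 87; 579; 1030];[:: 150; 811; 1252];[:: 256; 644; 1190];[:: 57; 517; 1192];
[:: 58; 814; 1513];[:: 271; 902; 1411];[:: 224; 583; 1290];[:: 31; 884; 1291];[:: 129; 520; 1037];[:: 161; 969; 1137];
[:: 290; 567; 1522];[:: 152; 778; 1031];[:: 419; 888; 1331];[:: 66; 907; 1204];[:: 255; 588; 1141];[:: 446; 880; 1142];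
[:: 105; 633; 1041];[:: 3; 526; 1171];[:: 299; 655; 1429];[:: 44; 956; 1110];[:: 69; 720; 1216];[:: 45; 829; 1495];
[:: 260; 657; 1465];[:: 303; 658; 1466];[:: 366; 724; 1083];[:: 103; 789; 1103];[:: 454; 726; 1404];[:: 228; 855; 1149];
[:: 180; 536; 1054];[:: 437; 894; 1311];[:: 73; 921; 1153];[:: 310; 831; 1504];[:: 136; 794; 1057];[:: 440; 987; 1378];
[:: 247; 605; 1507];[:: 368; 798; 1240];[:: 330; 927; 1342];[:: 75; 608; 1279];[:: 241; 994; 1435];[:: 269; 739; 1437];
[:: 507; 943; 1258];[:: 334; 996; 1515];[:: 509; 741; 1132];[:: 316; 679; 1453];[:: 340; 552; 1221];[:: 208; 873; 1262];
[:: 209; 618; 1391];[:: 405; 748; 1445];[:: 339; 941; 1383];[:: 93; 753; 1161];[:: 89; 626; 1271];[:: 154; 627; 1528];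
[:: 286; 885; 1420];[:: 220; 1014; 1456];[:: 360; 954; 1362];[:: 422; 955; 1172];[:: 27; 973; 1160];[:: 293; 979; 1422];
[:: 362; 832; 1040];[:: 12; 540; 1090];[:: 115; 513; 1497];[:: 178; 801; 1114];[:: 455; 898; 1052];[:: 18; 742; 1284];
[:: 151; 899; 1094];[:: 470; 875; 1060];[:: 64; 708; 1126];[:: 377; 965; 1256];[:: 378; 1006; 1449];[:: 463; 838; 1475];
[:: 160; 775; 1098];[:: 95; 564; 1483];[:: 65; 968; 1357];[:: 481; 905; 1329];[:: 354; 1015; 1202];[:: 344; 970; 1223];
[:: 227; 568; 1139];[:: 130; 715; 1396];[:: 319; 908; 1461];[:: 382; 688; 1206];[:: 169; 953; 1105];[:: 323; 974; 1235];
[:: 107; 719; 1109];[:: 108; 892; 1174];[:: 5; 528; 1152];[:: 365; 893; 1431];[:: 452; 849; 1529];[:: 367; 978; 1146];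
[:: 302; 916; 1147];[:: 39; 981; 1295];[:: 134; 662; 1084];[:: 292; 663; 1469];[:: 116; 984; 1374];[:: 373; 574; 1119];
[:: 137; 729; 1345];[:: 118; 1023; 1184];[:: 328; 986; 1249];[:: 376; 667; 1186];[:: 183; 797; 1059];[:: 48; 990; 1176];
[:: 394; 607; 1534];[:: 11; 928; 1215];[:: 177; 674; 1371];[:: 461; 675; 1117];[:: 187; 751; 1322];[:: 14; 548; 1195];
[:: 317; 933; 1196];[:: 380; 999; 1133];[:: 276; 1000; 1157];[:: 144; 553; 1326];[:: 145; 938; 1327];[:: 213; 940; 1381];
[:: 403; 621; 1063];[:: 29; 817; 1097];[:: 25; 946; 1207];[:: 474; 563; 1464];[:: 478; 693; 1100];[:: 28; 566; 1136];
[:: 424; 634; 1042];[:: 486; 891; 1364];[:: 91; 909; 1096];[:: 229; 915; 1102];[:: 42; 896; 1360];[:: 204; 860; 1282];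
[:: 435; 705; 1433];[:: 370; 993; 1178];[:: 7; 834; 1244];[:: 466; 678; 1220];[:: 215; 963; 1158];[:: 22; 939; 1380];
[:: 128; 516; 1062];[:: 185; 645; 1064];[:: 442; 686; 1129];[:: 143; 774; 1027];[:: 96; 711; 1162];[:: 159; 756; 1419];
[:: 257; 904; 1421];[:: 289; 585; 1521];[:: 162; 695; 1138];[:: 280; 906; 1415];[:: 35; 760; 1203];[:: 194; 523; 1076];
[:: 127; 972; 1269];[:: 318; 1008; 1526];[:: 233; 1017; 1425];[:: 131; 910; 1043];[:: 427; 783; 1301];[:: 172; 828; 1494];
[:: 197; 848; 1088];[:: 429; 701; 1111];[:: 132; 785; 1081];[:: 175; 530; 1082];[:: 494; 852; 1467];[:: 487; 917; 1231];
[:: 326; 854; 1276];[:: 356; 983; 1277];[:: 308; 920; 1438];[:: 53; 766; 1439];[:: 457; 793; 1281];[:: 182; 703; 1120];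
[:: 264; 666; 1441];[:: 312; 603; 1506];[:: 119; 989; 1123];[:: 496; 926; 1112];[:: 458; 543; 1470];[:: 459; 736; 1151];
[:: 113; 866; 1307];[:: 397; 867; 1053];[:: 123; 815; 1386];[:: 206; 868; 1131];[:: 381; 869; 1516];[:: 444; 807; 1325];
[:: 212; 936; 1093];[:: 336; 1001; 1134];[:: 337; 1002; 1519];[:: 21; 620; 1317];[:: 211; 813; 1255];[:: 221; 881; 1289];
[:: 473; 754; 1143];[:: 282; 1011; 1144];[:: 414; 1013; 1036];[:: 92; 630; 1328];[:: 232; 826; 1234];[:: 38; 571; 1300];
[:: 155; 845; 1032];[:: 165; 595; 1294];[:: 234; 960; 1424];[:: 140; 924; 1474];[:: 243; 641; 1113];[:: 50; 929; 1242];
[:: 327; 770; 1180];[:: 402; 614; 1156];[:: 23; 515; 1222];[:: 86; 1003; 1444];[:: 192; 580; 1254];[:: 505; 581; 1128];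
[:: 250; 622; 1065];[:: 335; 966; 1091];[:: 32; 903; 1226];[:: 223; 692; 1099];[:: 449; 584; 1229];[:: 97; 521; 1457];
[:: 226; 631; 1330];[:: 216; 586; 1351];[:: 99; 952; 1523];[:: 258; 587; 1268];[:: 191; 780; 1077];[:: 510; 560; 1078];
[:: 41; 569; 1489];[:: 451; 590; 1107];[:: 235; 591; 1493];[:: 236; 1020; 1302];[:: 389; 912; 1024];[:: 237; 765; 1047];
[:: 324; 721; 1145];[:: 495; 594; 1274];[:: 430; 532; 1531];[:: 423; 597; 1167];[:: 6; 534; 1212];[:: 420; 791; 1085];
[:: 500; 600; 1246];[:: 245; 958; 1503];[:: 9; 857; 1473];[:: 246; 639; 1312];[:: 200; 602; 1377];[:: 504; 539; 1058];
[:: 55; 925; 1443];[:: 176; 862; 1048];[:: 266; 991; 1150];[:: 395; 800; 1087];[:: 305; 546; 1243];[:: 333; 547; 1501];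
[:: 315; 623; 1450];[:: 142; 932; 1067];[:: 445; 549; 1068];[:: 252; 615; 1261];[:: 148; 616; 1285];[:: 272; 681; 1454];
[:: 17; 554; 1199];[:: 341; 812; 1253];[:: 19; 749; 1447];[:: 157; 945; 1481];[:: 409; 818; 1335];[:: 90; 947; 1080];
[:: 94; 821; 1228];[:: 156; 694; 1264];[:: 40; 762; 1426];[:: 358; 763; 1236];[:: 219; 525; 1480];[:: 101; 787; 1486];
[:: 426; 512; 1488];[:: 332; 988; 1410];[:: 307; 577; 1049];[:: 498; 865; 1050];[:: 391; 706; 1372];[:: 338; 550; 1348];
[:: 343; 835; 1286];[:: 406; 555; 1508];[:: 0; 900; 1446];[:: 313; 773; 1448];[:: 314; 558; 1257];[:: 15; 646; 1155];
[:: 480; 839; 1034];[:: 287; 628; 1035];[:: 385; 776; 1293];[:: 417; 713; 1393];[:: 34; 823; 1266];[:: 408; 522; 1287];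
[:: 163; 632; 1075];[:: 322; 651; 1460];[:: 511; 844; 1397];[:: 190; 624; 1398];[:: 361; 889; 1297];[:: 259; 782; 1427];
[:: 43; 911; 1173];[:: 300; 700; 1366];[:: 325; 976; 1472];[:: 301; 573; 1239];[:: 4; 913; 1209];[:: 47; 914; 1210];
[:: 110; 980; 1339];[:: 359; 533; 1359];[:: 198; 982; 1148];[:: 484; 599; 1405];[:: 436; 792; 1310];[:: 181; 638; 1055];
[:: 329; 665; 1409];[:: 54; 575; 1248];[:: 392; 538; 1313];[:: 184; 731; 1122];[:: 503; 861; 1251];[:: 112; 542; 1496];
[:: 74; 671; 1086];[:: 331; 864; 1535];[:: 497; 738; 1179];[:: 13; 995; 1181];[:: 251; 687; 1514];[:: 78; 740; 1259];
[:: 253; 997; 1388];[:: 60; 935; 1197];[:: 84; 808; 1477];[:: 464; 617; 1518];[:: 465; 874; 1135];[:: 149; 1004; 1189];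
[:: 83; 685; 1127];[:: 349; 1009; 1417];[:: 345; 882; 1527];[:: 410; 883; 1272];[:: 30; 629; 1164];[:: 476; 758; 1200];
[:: 104; 698; 1106];[:: 166; 699; 1428];[:: 283; 717; 1416];[:: 37; 723; 1166];[:: 106; 576; 1296];[:: 268; 796; 1346];
[:: 371; 769; 1241];[:: 434; 545; 1370];[:: 199; 642; 1308];[:: 274; 998; 1028];[:: 407; 643; 1350];[:: 214; 619; 1316];
[:: 320; 964; 1382];[:: 121; 709; 1512];[:: 122; 750; 1193];[:: 207; 582; 1219];[:: 416; 519; 1354];[:: 351; 820; 1227];
[:: 321; 712; 1101];[:: 225; 649; 1073];[:: 98; 759; 1458];[:: 88; 714; 1479];[:: 483; 824; 1395];[:: 386; 971; 1140];
[:: 63; 652; 1205];[:: 126; 944; 1462];[:: 425; 697; 1361];[:: 67; 718; 1491];[:: 363; 975; 1365];[:: 364; 636; 1430];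
[:: 261; 784; 1408];[:: 109; 637; 1175];[:: 196; 593; 1273];[:: 111; 722; 1402];[:: 46; 660; 1403];[:: 295; 725; 1039];
[:: 390; 918; 1340];[:: 36; 919; 1213];[:: 372; 728; 1118];[:: 117; 830; 1375];[:: 393; 985; 1089];[:: 374; 767; 1440];
[:: 72; 730; 1505];[:: 120; 923; 1442];[:: 439; 541; 1315];[:: 304; 734; 1432];[:: 138; 863; 1278];[:: 267; 672; 1471];
[:: 433; 930; 1115];[:: 205; 931; 1373];[:: 443; 1007; 1066];[:: 270; 804; 1451];[:: 61; 677; 1452];[:: 124; 743; 1389];
[:: 20; 744; 1413];[:: 400; 809; 1070];[:: 401; 682; 1071];[:: 469; 684; 1125];[:: 147; 877; 1319];[:: 285; 561; 1353];
[:: 281; 690; 1463];[:: 218; 819; 1208];[:: 222; 949; 1356];[:: 284; 822; 1392];[:: 168; 890; 1298];[:: 230; 635; 1108];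
[:: 347; 653; 1352];[:: 485; 659; 1358];[:: 298; 640; 1104];[:: 460; 604; 1026];[:: 179; 961; 1177];[:: 114; 737; 1434];
[:: 263; 578; 1500];[:: 210; 934; 1476];[:: 471; 707; 1414];[:: 278; 683; 1124];[:: 384; 772; 1318];[:: 441; 901; 1320];
[:: 186; 942; 1385];[:: 399; 518; 1283];[:: 352; 967; 1418];[:: 415; 1012; 1163];[:: 1; 648; 1165];[:: 33; 841; 1265];
[:: 418; 951; 1394];[:: 24; 650; 1159];[:: 291; 1016; 1459];[:: 450; 779; 1332];[:: 383; 716; 1525];[:: 62; 752; 1270];
[:: 489; 761; 1169];[:: 387; 654; 1299];[:: 171; 527; 1045];[:: 428; 572; 1238];[:: 453; 592; 1344];[:: 173; 957; 1367];
[:: 388; 529; 1337];[:: 431; 786; 1338];[:: 238; 596; 1211];[:: 231; 661; 1487];[:: 70; 598; 1532];[:: 100; 727; 1533];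
[:: 52; 664; 1182];[:: 309; 1022; 1183];[:: 201; 537; 1025];[:: 438; 959; 1376];[:: 8; 922; 1185];[:: 56; 859; 1250];
[:: 375; 733; 1379];[:: 240; 670; 1368];[:: 202; 799; 1214];[:: 203; 992; 1407];[:: 369; 610; 1051];[:: 141; 611; 1309];
[:: 379; 559; 1130];[:: 462; 612; 1387];[:: 125; 613; 1260];[:: 188; 551; 1069];[:: 468; 680; 1349];[:: 80; 745; 1390];
[:: 81; 746; 1263];[:: 277; 876; 1061];[:: 467; 557; 1511];[:: 477; 625; 1033];[:: 217; 1010; 1399];[:: 26; 755; 1400];
[:: 158; 757; 1292];[:: 348; 886; 1072];[:: 488; 570; 1490];[:: 294; 827; 1044];[:: 411; 589; 1288];[:: 421; 851; 1038];
[:: 490; 704; 1168];[:: 396; 668; 1218];[:: 499; 897; 1369];[:: 306; 673; 1498];[:: 71; 514; 1436];[:: 146; 870; 1412];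
[:: 279; 771; 1478];[:: 342; 747; 1188];[:: 448; 836; 1510];[:: 249; 837; 1384];[:: 506; 878; 1321];[:: 79; 710; 1347];
[:: 288; 647; 1482];[:: 479; 948; 1355];[:: 193; 840; 1485];[:: 353; 777; 1201];[:: 482; 887; 1074];[:: 472; 842; 1095];
[:: 355; 696; 1267];[:: 2; 843; 1524];[:: 447; 524; 1333];[:: 254; 816; 1334];[:: 297; 825; 1233];[:: 195; 846; 1363];
[:: 491; 847; 1237];[:: 492; 764; 1046];[:: 133; 656; 1280];[:: 493; 1021; 1303];[:: 68; 977; 1401];[:: 239; 850; 1530];
[:: 174; 788; 1275];[:: 167; 853; 1423];[:: 262; 790; 1468];[:: 164; 535; 1341];[:: 244; 856; 1502];[:: 501; 702; 1247];
[:: 265; 601; 1217];[:: 502; 895; 1056];[:: 456; 858; 1121];[:: 248; 795; 1314];[:: 311; 669; 1187];[:: 432; 606; 1304];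
[:: 10; 735; 1406];[:: 139; 544; 1343];[:: 49; 802; 1499];[:: 77; 803; 1245];[:: 59; 879; 1194];[:: 398; 676; 1323];
[:: 189; 805; 1324];[:: 508; 871; 1517];[:: 404; 872; 1029];[:: 16; 937; 1198];[:: 273; 810; 1455];[:: 85; 556; 1509];
[:: 275; 1005; 1191];[:: 413; 689; 1225];[:: 153; 562; 1079];[:: 346; 691; 1336];[:: 350; 565; 1484];[:: 412; 950; 1520];
[:: 296; 1018; 1170];[:: 102; 1019; 1492]]%num.

(** * The 17-cycle, fast access to the table, and the verification by computation *)

Definition cyc : seq N := [:: 0; 857; 756; 359; 1298; 1252; 144; 802; 2030; 1499; 304; 1899; 1432; 183; 791; 900; 1802]%num.

(** A binary trie reaches a row in at most 11 steps, against about a thousand on average for a scan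
    of the list. Keys of type [positive] start at 1, so the row of vertex [x] is stored under x +
    1. *)
Fixpoint store (i : positive) (t : seq (seq N)) : PositiveMap.t (seq N) :=
  if t is s :: t' then PositiveMap.add i s (store (Pos.succ i) t')
  else PositiveMap.empty _.

Definition index := store 1 table.

(* The test makes [nbrs] vanish outside the range without any fact on [index]. *)
Definition nbrs (x : N) : seq N :=
  if N.ltb x 2048 then odflt [::] (PositiveMap.find (N.succ_pos x) index)
  else [::].

Lemma nbrs_out x : ~~ N.ltb x (N.of_nat 2048) -> nbrs x = [::].
Proof. by rewrite /nbrs => /negbTE ->. Qed.

(** Merge sort followed by one pass for strict increase takes the place of the quadratic [uniq],
    which would make some 300000 comparisons for each of the 2048 roots. *)
Definition distinct (s : seq N) := sorted N.ltb (sort N.leb s).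

Lemma distinct_uniq s : distinct s -> uniq s.
Proof.
(* Sorting permutes the list whatever the relation; a list increasing for the transitive and
   irreflexive [N.ltb] has no repetition. *)
rewrite -(sort_uniq N.leb); apply: sorted_uniq => [y x z|x].
  by move=> /N.ltb_lt xy /N.ltb_lt yz; apply/N.ltb_lt; lia.
exact: N.ltb_irrefl.
Qed.

(** This also certifies that the table has no missing row: the default of [nbrs] is empty and would
    fail the test for three neighbours. *)
Lemma nbrs_ok : table_ok 2048 nbrs 3.
Proof. by vm_compute. Qed.

(** The heart of the verification: at each root the 766 endpoints are pairwise different, so every
    ball of radius 8 meets the Moore bound for girth 17. *)
Lemma nbrs_tree : all (fun x => distinct (spread nbrs 8 x x)) (vertices 2048).
Proof. by vm_compute. Qed.

(** Counting alone does not rule out girth 18, whose Moore bound 2 (2^9 - 1) = 1022 is below 2048,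
    so a 17-cycle has to be shown. Seen from the vertex 0, it is closed by the edge between 2030 and
    1499, two leaves at depth 8 in different branches. *)
Lemma nbrs_cycle : ucycle (fun x y => y \in nbrs x) cyc.
Proof. by apply/andP; vm_compute. Qed.

Lemma nbrs_spread : all (fun x => uniq (spread nbrs 8 x x)) (vertices 2048).
Proof. exact: sub_all (fun x => @distinct_uniq _) _ nbrs_tree. Qed.

Lemma cyc_lt : all (fun x => N.ltb x (N.of_nat 2048)) cyc.
Proof. by vm_compute. Qed.

Theorem mainTheorem2 :
  (exists2 n : nat, min_order 3 17 n & n <= 2048) /\
  (exists2 G : sgraph, kg_graph 3 17 G & #|G| <= 2048).
Proof.
have kgG : kg_graph 3 17 (table_graph nbrs_ok).
  split; first exact: table_graph_regular.
  (* Here [g] is 8, and 17 is [8.*2.+1] by conversion; the length of [cyc] and [0 < 8] are settled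
     by evaluation. *)
  exact: (table_graph_girth nbrs_ok nbrs_out nbrs_spread nbrs_cycle cyc_lt).
have leG : #|table_graph nbrs_ok| <= 2048 by rewrite card_ord.
split; last by exists (table_graph nbrs_ok).
by have [n minn len] := min_order_exists kgG; exists n; last apply: leq_trans len leG.
Qed.
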